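(* Let $0\le m\le n$ be integers with $n\ge1$, let $X\in\mathbb C$, and let $A,B,C,D$ be generic complex numbers, i.e. $A-B\notin\{-(n+1),\dots,n+1\}$; $A+B,\ A+C,\ A+D,\ B+C,\ B+D\notin\{0,-1,\dots,-(n-1)\}$; $2A,\,2B\notin\{-1,\dots,-(2n-1)\}$; and $A+B+C+D\notin\{0,-1,\dots,-(2n-2)\}$. For $q\in(0,1)$ put $a=q^A$, $b=q^B$, $c=q^C$, $d=q^D$, $z=q^{iX}$, $x=\frac12(q^{iX}+q^{-iX})$, and let $$p_m(x;a,b,c,d\,|\,q)=\sum_{k=0}^nA_k(n,m)\,\widetilde{\mathcal B}^{\,n}_k(x;a,b)$$ be the connection identity, with (for $q$ close to $1$) uniquely determined coefficients $A_k(n,m)$. Divide this identity by $(1-q)^{3m}$ and let $q\uparrow1$. Then $(1-q)^{-3m}p_m\to W_m(X^2;A,B,C,D)$, $(1-q)^{-2k}\varphi_k(x;q^A)\to\rho_k(X;A)$, $(1-q)^{-2(n-k)}\varphi_{n-k}(x;q^B)\to\rho_{n-k}(X;B)$, and $$(1-q)^{2n-3m}A_k(n,m)\to\bar\pi_{n,k}\,\bar\omega_{n,m}\,R^{\mathrm{Racah}}_m(\lambda(k)),$$ so that the powers of $(1-q)$ balance and the limit is the Wilson connection identity $$W_m(X^2;A,B,C,D)=\sum_{k=0}^n\bar\pi_{n,k}\,\bar\omega_{n,m}\,R^{\mathrm{Racah}}_m(\lambda(k))\,\binom nk\,\rho_k(X;A)\,\rho_{n-k}(X;B),$$ where $$\bar\pi_{n,k}=\frac{B-A+n-2k}{(A+B)_n\,(B-A)_{n-k}\,(B-A+n-k)\,(A-B+1)_k},\qquad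 \bar\omega_{n,m}=(A+B)_m(A+C)_m(A+D)_m,$$ $$R^{\mathrm{Racah}}_m(\lambda(k))={}_4F_3\!\left[\begin{matrix}-m,\ A+B+C+D+m-1,\ -k,\ A-B+k-n\\ A+D,\ A+C,\ -n\end{matrix};1\right],\qquad \lambda(k)=k(k+A-B-n),$$ which is the Racah polynomial with parameters $(A+D-1,\,B+C-1,\,-n-1,\,A-B)$.
   Context: Notation: $(c;q)_k=\prod_{j=0}^{k-1}(1-cq^j)$, $(c_1,\dots,c_r;q)_k=\prod_i(c_i;q)_k$, $(c)_k=\prod_{j=0}^{k-1}(c+j)$. With $x=\frac12(z+z^{-1})$: $\varphi_k(x;a)=(az,a/z;q)_k$ and $\widetilde{\mathcal B}^{\,n}_k(x;a,b)=\binom nk\varphi_k(x;a)\varphi_{n-k}(x;b)$. The Askey–Wilson polynomials are $$p_m(x;a,b,c,d\,|\,q)=a^{-m}(ab,ac,ad;q)_m\sum_{j=0}^{m}\frac{(q^{-m},abcd\,q^{m-1},az,a/z;q)_j}{(q,ab,ac,ad;q)_j}\,q^j .$$ The Wilson generalized powers are $\rho_k(X;A)=(A+iX)_k(A-iX)_k$, a polynomial of degree $k$ in $X^2$. The Wilson polynomials are $$W_m(X^2;A,B,C,D)=(A+B)_m(A+C)_m(A+D)_m\;{}_4F_3\!\left[\begin{matrix}-m,\ A+B+C+D+m-1,\ A+iX,\ A-iX\\ A+B,\ A+C,\ A+D\end{matrix};1\right].$$ Here ${}_4F_3\!\left[\begin{matrix}a_1,\dots,a_4\\ b_1,b_2,b_3\end{matrix};1\right]=\sum_{j\ge0}\frac{(a_1)_j\cdots(a_4)_j}{(b_1)_j(b_2)_j(b_3)_j\,j!}$,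 terminated by the parameter $-m$ (or $-k$ if smaller). The Racah polynomial with parameters $(\alpha,\beta,\gamma,\delta)$ is ${}_4F_3\!\left[\begin{matrix}-m,\ m+\alpha+\beta+1,\ -k,\ k+\gamma+\delta+1\\ \alpha+1,\ \beta+\delta+1,\ \gamma+1\end{matrix};1\right]$ in the variable $\lambda(k)=k(k+\gamma+\delta+1)$. *)

(* Defs.v *)
(* MathComp-Analysis; complex numbers are R[i] for R : realType. *)
From HB Require Import structures.
From mathcomp Require Import all_boot all_order all_algebra.
From mathcomp Require Import all_classical all_reals all_analysis.
From mathcomp Require Import complex ring.
Set Implicit Arguments.
Unset Strict Implicit.
Unset Printing Implicit Defensive.
Import Order.TTheory GRing.Theory Num.Theory numFieldNormedType.Exports.
Local Open Scope ring_scope.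
Local Open Scope complex_scope.

Section Pochhammer.
Variable K : fieldType.
Implicit Types (c q : K) (cs num den : seq K) (k N : nat).

Definition qpoch c q k : K := \prod_(j < k) (1 - c * q ^+ j).

Definition qpochs cs q k : K := \prod_(c <- cs) qpoch c q k.

Definition rising c k : K := \prod_(j < k) (c + j%:R).

(* Hypergeometric series at argument 1 terminated after the term of index N;
   N has to be the value at which a numerator parameter -N stops the series,
   since a denominator parameter may be a negative integer too. *)
Definition hypergeom N num den : K :=
  \sum_(j < N.+1)
     (\prod_(c <- num) rising c j) / ((\prod_(c <- den) rising c j) * j`!%:R).

End Pochhammer.

(* Functions of x = (z + z^-1) / 2 are parametrized by z != 0; they are
   invariant under z |-> z^-1 (lemmas phiV and askey_wilsonV). *)
Section AskeyWilson.
Variable K : fieldType.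
Implicit Types (z a b c d q : K) (n m k : nat).

Definition phi k z a q : K := qpochs [:: a * z; a / z] q k.

Definition qbernstein n k z a b q : K :=
  'C(n, k)%:R * phi k z a q * phi (n - k) z b q.

(* The exponent of q ^ (m - 1) is an int: it is -1 when m = 0. *)
Definition askey_wilson m z a b c d q : K :=
  a ^- m * qpochs [:: a * b; a * c; a * d] q m *
  \sum_(j < m.+1)
     qpochs [:: q ^- m; a * b * c * d * q ^ (m%:Z - 1); a * z; a / z] q j
     / qpochs [:: q; a * b; a * c; a * d] q j * q ^+ j.

Lemma phiV k z a q : phi k z^-1 a q = phi k z a q.
Proof. by rewrite /phi /qpochs !big_cons !big_nil invrK mulrCA. Qed.

Lemma askey_wilsonV m z a b c d q :
  askey_wilson m z^-1 a b c d q = askey_wilson m z a b c d q.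
Proof.
rewrite /askey_wilson; congr (_ * _); apply: eq_bigr => j _.
congr (_ / _ * _); rewrite /qpochs !big_cons !big_nil invrK.
by do 2! congr (_ * _); rewrite mulrCA.
Qed.

End AskeyWilson.

(* Functions of k in the variable racah_lambda k (lemma racah_polynomial). *)
Section Racah.
Variable K : fieldType.
Implicit Types (alpha beta gamma delta : K) (m k : nat).

Definition racah_lambda gamma delta k : K :=
  k%:R * (k%:R + gamma + delta + 1).

Definition racah m alpha beta gamma delta k : K :=
  hypergeom (minn m k)
    [:: - m%:R; m%:R + alpha + beta + 1; - k%:R; k%:R + gamma + delta + 1]
    [:: alpha + 1; beta + delta + 1; gamma + 1].

Lemma rising_eq0 j k : (k < j)%N -> rising (- k%:R : K) j = 0.
Proof.
by move=> kj; rewrite /rising (bigD1 (Ordinal kj)) //= addrC subrr mul0r.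
Qed.

Lemma racah_polynomial m alpha beta gamma delta :
  exists2 p : {poly K}, (size p <= m.+1)%N &
    forall k, racah m alpha beta gamma delta k = p.[racah_lambda gamma delta k].
Proof.
pose f (j : nat) : {poly K} :=
  \prod_(i < j) ((i%:R * (i%:R + gamma + delta + 1))%:P - 'X).
pose c (j : nat) : K := rising (- m%:R) j *
  rising (m%:R + alpha + beta + 1) j / (rising (alpha + 1) j *
  (rising (beta + delta + 1) j * rising (gamma + 1) j) * j`!%:R).
have fE j k : rising (- k%:R) j * rising (k%:R + gamma + delta + 1) j
    = (f j).[racah_lambda gamma delta k].
  rewrite /f horner_prod /rising -big_split /=; apply: eq_bigr => i _.
  by rewrite !hornerE /racah_lambda; ring.
have sizef j : (size (f j) <= j.+1)%N.
  elim: j => [|j IH]; first by rewrite /f big_ord0 size_poly1.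
  rewrite /f big_ord_recr /=; apply: leq_trans (size_polyMleq _ _) _.
  rewrite -/(f j) -opprB size_polyN size_XsubC addn2 /=.
  by rewrite ltnS.
exists (\sum_(j < m.+1) c j *: f j).
  apply: leq_trans (size_sum _ _ _) _; apply/bigmax_leqP => j _.
  apply: leq_trans (size_scale_leq _ _) _.
  exact: leq_trans (sizef j) (ltn_ord j).
move=> k; rewrite /racah /hypergeom horner_sum.
pose g j := c j * (f j).[racah_lambda gamma delta k].
transitivity (\sum_(j < (minn m k).+1) g j).
  apply: eq_bigr => j _; rewrite /g -fE /c !big_cons !big_nil !mulr1 -!mulrA.
  by do 2! congr (_ * _); rewrite [RHS]mulrC -!mulrA.
rewrite (big_ord_widen m.+1 g) ?ltnS ?geq_minl // big_mkcond /=.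
apply: eq_bigr => j _; rewrite hornerZ /g; case: ifPn => //.
rewrite ltnS leq_min -ltnS ltn_ord /= -ltnNge => kj.
by rewrite -fE rising_eq0 // mul0r mulr0.
Qed.

End Racah.

Section WilsonLimit.
Variable R : realType.
Implicit Types (q : R) (w X A B C D : R[i]) (n m k : nat).

(* q ^ w = exp (w * ln q) for q > 0 and a complex exponent w *)
Definition cpow q w : R[i] :=
  (expR (complex.Re w * ln q))%:C *
  (cos (complex.Im w * ln q) +i* sin (complex.Im w * ln q)).

(* Functions of X ^ 2 are parametrized by X (lemmas rhoN and wilsonN). *)
Definition rho k X A : R[i] := rising (A + 'i%C * X) k * rising (A - 'i%C * X) k.

Definition wilson m X A B C D : R[i] :=
  rising (A + B) m * rising (A + C) m * rising (A + D) m *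
  hypergeom m
    [:: - m%:R; A + B + C + D + m%:R - 1; A + 'i%C * X; A - 'i%C * X]
    [:: A + B; A + C; A + D].

Lemma rhoN k X A : rho k (- X) A = rho k X A.
Proof. by rewrite /rho mulrN opprK mulrC. Qed.

Lemma wilsonN m X A B C D : wilson m (- X) A B C D = wilson m X A B C D.
Proof.
rewrite /wilson /hypergeom mulrN opprK; congr (_ * _); apply: eq_bigr => j _.
by congr (_ / _); rewrite !big_cons !big_nil !mulr1; do 2! congr (_ * _);
  rewrite mulrC.
Qed.

Definition generic n A B C D : Prop :=
  [/\ forall j : int, - n.+1%:Z <= j <= n.+1%:Z -> A - B != j%:~R,
      forall s, s \in [:: A + B; A + C; A + D; B + C; B + D] ->
        forall j : nat, (j <= n.-1)%N -> s != - j%:R,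
      forall s, s \in [:: A; B] ->
        forall j : nat, (1 <= j <= (2 * n).-1)%N -> 2 * s != - j%:R
    & forall j : nat, (j <= 2 * n - 2)%N -> A + B + C + D != - j%:R].

(* The connection identity for given q, as an identity between polynomials
   in x, i.e. for all z != 0. *)
Definition connection n m A B C D q (coef : {ffun 'I_n.+1 -> R[i]}) : Prop :=
  forall z : R[i], z != 0 ->
    askey_wilson m z (cpow q A) (cpow q B) (cpow q C) (cpow q D) q%:C
    = \sum_(k < n.+1) coef k * qbernstein n k z (cpow q A) (cpow q B) q%:C.

Definition pibar n k A B : R[i] :=
  (B - A + n%:R - 2 * k%:R) /
  (rising (A + B) n * rising (B - A) (n - k) * (B - A + (n - k)%:R)
   * rising (A - B + 1) k).

Definition omegabar m A B C D : R[i] :=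
  rising (A + B) m * rising (A + C) m * rising (A + D) m.

Definition Rracah n m A B C D k : R[i] :=
  hypergeom (minn m k)
    [:: - m%:R; A + B + C + D + m%:R - 1; - k%:R; A - B + k%:R - n%:R]
    [:: A + D; A + C; - n%:R].

Definition lambda n A B k : R[i] := k%:R * (k%:R + A - B - n%:R).

End WilsonLimit.

(* Main.v *)
(* The q-Bernstein polynomials phi_l(x; a) phi_{N-l}(x; b) admit an explicit
   partition of unity: 1 is a combination of phi_1(x; a q^l) and
   phi_1(x; b q^(N-l)), which raises the degree N by one.  Since
   phi_j(x; a) phi_l(x; a q^j) = phi_{j+l}(x; a), the partition of unity with
   parameters (a q^j, b) and degree n - j expands each phi_j(x; a) in the
   q-Bernstein basis, and with it the defining sum of p_m.  The basis is free,
   as shown by evaluating at z = 1 / (b q^i).  All coefficients are products and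
   quotients of factors 1 - q^w, and (1 - q^w) / (1 - q) tends to w as q tends
   to 1; so they converge termwise after scaling by powers of 1 - q, and the
   Wilson identity follows by uniqueness of limits. *)
Require Import Defs.
From HB Require Import structures.
From mathcomp Require Import all_boot all_order all_algebra.
From mathcomp Require Import all_classical all_reals all_analysis.
From mathcomp Require Import complex.
From mathcomp Require Import ring.
Set Implicit Arguments.
Unset Strict Implicit.
Unset Printing Implicit Defensive.
Import Order.TTheory GRing.Theory Num.Theory numFieldNormedType.Exports.
Local Open Scope ring_scope.
Local Open Scope classical_set_scope.
Local Open Scope complex_scope.

(** * q-Bernstein expansions *)

Section QBernstein.
Variable K : fieldType.
Implicit Types (a b c d q s t z : K) (j k l m n N : nat).

Lemma qpochS c q k : qpoch c q k.+1 = qpoch c q k * (1 - c * q ^+ k).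
Proof. by rewrite /qpoch big_ord_recr. Qed.

Lemma qpochD c q j k : qpoch c q (j + k) = qpoch c q j * qpoch (c * q ^+ j) q k.
Proof.
elim: k => [|k IH]; first by rewrite addn0 /qpoch !big_ord0 mulr1.
by rewrite addnS !qpochS IH -mulrA exprD -(mulrA c).
Qed.

Lemma qpoch_neq0_le c q j k :
  (j <= k)%N -> qpoch c q k != 0 -> qpoch c q j != 0.
Proof. by move=> /subnK <-; rewrite addnC qpochD mulf_eq0 => /norP[]. Qed.

Lemma risingS c k : rising c k.+1 = rising c k * (c + k%:R).
Proof. by rewrite /rising big_ord_recr. Qed.

Lemma risingD c j k : rising c (j + k) = rising c j * rising (c + j%:R) k.
Proof.
elim: k => [|k IH]; first by rewrite addn0 /rising !big_ord0 mulr1.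
by rewrite addnS !risingS IH natrD addrA mulrA.
Qed.

Lemma rising_neq0 c k :
  (forall j, (j < k)%N -> c + j%:R != 0) -> rising c k != 0.
Proof. by move=> h; apply/prodf_neq0 => i _; apply: h. Qed.

Lemma phiE k z a q : phi k z a q = qpoch (a * z) q k * qpoch (a / z) q k.
Proof. by rewrite /phi /qpochs !big_cons big_nil mulr1. Qed.

Lemma phiS k z a q : phi k.+1 z a q =
  phi k z a q * ((1 - a * z * q ^+ k) * (1 - a / z * q ^+ k)).
Proof. by rewrite !phiE !qpochS mulrACA. Qed.

Lemma phiD j k z a q :
  phi (j + k) z a q = phi j z a q * phi k z (a * q ^+ j) q.
Proof.
by rewrite !phiE !qpochD mulrACA [a * z * _]mulrAC [a / z * _]mulrAC.
Qed.

(** The Gaussian binomial coefficient, defined by the q-Pascal rule so that no division by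
    [1 - q ^+ j] occurs and the limit at [q = 1] follows the same recursion. *)
Fixpoint qbin q N l : K :=
  match N, l with
  | _, 0 => 1
  | 0, _.+1 => 0
  | N'.+1, l'.+1 => q ^+ l * qbin q N' l + qbin q N' l'
  end.

Lemma qbin0 q N : qbin q N 0 = 1.
Proof. by case: N. Qed.

Lemma qbinS q N l :
  qbin q N.+1 l.+1 = q ^+ l.+1 * qbin q N l.+1 + qbin q N l.
Proof. by []. Qed.

Lemma qbin_small q N l : (N < l)%N -> qbin q N l = 0.
Proof.
elim: N l => [|N IH] [|l] //= Nl.
by rewrite !IH ?mulr0 ?addr0 // ltnW.
Qed.

(** Induction on [N] through the q-Pascal rule; for [l = N] both sides vanish. It serves to pass
    between the two q-Pascal rules. *)
Lemma qbin_ratio q N l : (l <= N)%N ->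
  (1 - q ^+ l.+1) * qbin q N l.+1 = (1 - q ^+ (N - l)) * qbin q N l.
Proof.
elim: N l => [|N IH] l.
  by rewrite leqn0 => /eqP ->; rewrite /= mulr0 subrr mul0r.
case: l => [_|l]; last rewrite ltnS => lN.
  by rewrite qbinS mulrDr mulrCA IH // !subn0 !qbin0 expr1 (exprS q N); ring.
rewrite subSS qbinS; case: (ltnP l N) => [lN'|Nl].
  rewrite mulrDr mulrCA (IH l.+1) // qbinS mulrDr -(IH l) //.
  have -> : (N - l = (N - l.+1).+1)%N by rewrite subnSK.
  by rewrite !exprS; ring.
have -> : l = N by apply/eqP; rewrite eqn_leq lN Nl.
by rewrite (qbin_small q (ltnSn N)) (@qbin_small q N N.+2) // subnn subrr; ring.
Qed.

(** The mirrored q-Pascal rule: its discrepancy with [qbinS] is exactly the relation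
    [qbin_ratio]. *)
Lemma qbinS' q N l : (l <= N)%N ->
  qbin q N.+1 l.+1 = qbin q N l.+1 + q ^+ (N - l) * qbin q N l.
Proof.
move=> lN; have := qbin_ratio q lN; rewrite qbinS.
move: (q ^+ l.+1) (q ^+ (N - l)) => x y h; apply/eqP; rewrite -subr_eq0.
by rewrite (_ : _ - _ = (1 - y) * qbin q N l - (1 - x) * qbin q N l.+1);
  [rewrite h subrr | ring].
Qed.

(* With s = a b and t = b / a, the coefficients in partition_of_unity. *)
Definition unity_coef q s t N l : K :=
  qbin q N l * (q ^+ l - t * q ^+ (N - l)) /
  (qpoch s q N * qpoch t q (N - l).+1 * qpoch (q / t) q l).

(** Induction on [N]: every term of degree [N] splits into two neighbouring terms of degree [N.+1],
    and the contributions to each product are collected by the two q-Pascal rules. *)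
Lemma partition_of_unity a b q z N : a != 0 -> b != 0 -> z != 0 ->
    qpoch (a * b) q N != 0 -> qpoch (b / a) q N.+1 != 0 ->
    qpoch (q / (b / a)) q N != 0 ->
  \sum_(l < N.+1)
     unity_coef q (a * b) (b / a) N l * phi l z a q * phi (N - l) z b q = 1.
Proof.
move=> a0 b0 z0; set s := a * b; set t := b / a.
have t0 : t != 0 by rewrite mulf_neq0 ?invr_neq0.
elim: N => [|N IH].
  rewrite big_ord1 /unity_coef !phiE /qpoch !big_ord0 !big_ord1 /= => _ t1 _.
  by rewrite !expr0 !mulr1 !mul1r divff //; move: t1; rewrite expr0 mulr1.
rewrite qpochS mulf_eq0 => /norP[sN s1].
rewrite qpochS mulf_eq0 => /norP[tN t1].
rewrite qpochS mulf_eq0 => /norP[uN u1].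
(* The degree is raised by
   q^l phi_1(x; b q^r) - t q^r phi_1(x; a q^l) = (q^l - t q^r) (1 - s q^N),
   where r = N - l. *)
pose G l := qbin q N l /
  (qpoch s q N.+1 * qpoch t q (N - l).+1 * qpoch (q / t) q l).
pose P l := phi l z a q; pose Q r := phi r z b q.
have lower l : (l <= N)%N ->
  unity_coef q s t N l * P l * Q (N - l)%N =
  G l * q ^+ l * P l * Q (N - l).+1
  - G l * (t * q ^+ (N - l)) * P l.+1 * Q (N - l)%N.
  move=> lN; rewrite /P /Q !phiS /G /unity_coef (qpochS s).
  set r := (N - l)%N; set Pl := phi l _ _ _; set Qr := phi r _ _ _.
  have eN : q ^+ N = q ^+ l * q ^+ r by rewrite -exprD subnKC.
  rewrite eN in s1 *.
  move: (q ^+ l) (q ^+ r) s1 => x y s1.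
  move: (qbin q N l) (qpoch s q N) (qpoch t q r.+1) (qpoch (q / t) q l).
  move=> B S T U; rewrite !invfM.
  move: S^-1 T^-1 U^-1 => {}S {}T {}U.
  rewrite /s /t in s1 *; field.
  by rewrite a0 z0 s1.
(* The product [P l.+1 * Q (N - l)] receives one contribution from index [l.+1] and one from index
   [l]. *)
have raise l : (l <= N)%N -> unity_coef q s t N.+1 l.+1 =
    G l.+1 * q ^+ l.+1 - G l * (t * q ^+ (N - l)).
  move=> lN; rewrite /G /unity_coef subSS.
  have ul : 1 - q / t * q ^+ l != 0 /\ qpoch (q / t) q l != 0.
    have : qpoch (q / t) q l.+1 != 0.
      by apply: (@qpoch_neq0_le _ _ _ N.+1) => //; rewrite qpochS mulf_neq0.
    by rewrite qpochS mulf_eq0 => /norP[].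
  have sN1 : qpoch s q N.+1 != 0 by rewrite qpochS mulf_neq0.
  have [u1l ull] := ul.
  have tr : 1 - t * q ^+ (N - l) != 0 /\ qpoch t q (N - l) != 0.
    have : qpoch t q (N - l).+1 != 0.
      apply: (@qpoch_neq0_le _ _ _ N.+1) => //.
      by rewrite ltnS leq_subr.
    by rewrite qpochS mulf_eq0 => /norP[].
  have [t1r trr] := tr.
  (* [qbinS'] expands the part with [q ^+ l.+1] and [qbinS] the part with [t]; the brackets so
     formed cancel the last factors of the symbols in [t] and [q / t]. *)
  rewrite (_ : qbin q N.+1 l.+1 * (q ^+ l.+1 - t * q ^+ (N - l)) =
    qbin q N l.+1 * q ^+ l.+1 * (1 - t * q ^+ (N - l))
    - qbin q N l * (t * q ^+ (N - l)) * (1 - q / t * q ^+ l)); last first.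
    by rewrite mulrBr {1}qbinS' // qbinS exprS; field.
  rewrite (qpochS t) (qpochS _ _ l).
  (* For [l = N] truncated subtraction makes [(N - l.+1).+1] equal to 1 instead of [N - l], but then
     [G l.+1] vanishes with its [qbin]. *)
  case: (ltnP l N) => [lN'|Nl].
    rewrite subnSK //.
    move: (qbin q N l.+1) (qbin q N l) (q ^+ l.+1) => B B' w.
    move: (q ^+ l) (q ^+ (N - l)) u1l t1r => x y u1l t1r.
    move: (qpoch s q N.+1) (qpoch t q (N - l)) (qpoch (q / t) q l) sN1 trr ull.
    move=> S T U S0 T0 U0.
    move: (1 - q / t * x) (1 - t * y) u1l t1r => g h g0 h0.
    by field; rewrite S0 T0 U0 g0 h0.
  rewrite (@qbin_small q N l.+1) // !mul0r !sub0r.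
  move: (qpoch s q N.+1) (qpoch t q (N - l)) (qpoch (q / t) q l) sN1 trr ull.
  move=> S T U S0 T0 U0; move: (qbin q N l) => B; move: (q ^+ l) (q ^+ (N - l)) u1l t1r => x y u1l t1r.
  move: (1 - q / t * x) (1 - t * y) u1l t1r => g h g0 h0.
  by field; rewrite S0 T0 U0 g0 h0.
rewrite -(IH sN tN uN).
rewrite [RHS](eq_bigr (fun l : 'I_N.+1 =>
  G l * q ^+ l * P l * Q (N.+1 - l)%N -
  G l * (t * q ^+ (N - l)) * P l.+1 * Q (N - l)%N)); last first.
  move=> l _; have lN : (l <= N)%N by rewrite -ltnS.
  by rewrite subSn //; exact: lower.
rewrite sumrB.
(* The added term has a vanishing [qbin]. The two families can then be aligned once [l = 0], which
   only the first one reaches, is split off. *)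
have -> : \sum_(l < N.+1) G l * q ^+ l * P l * Q (N.+1 - l)%N =
          \sum_(l < N.+2) G l * q ^+ l * P l * Q (N.+1 - l)%N.
  rewrite [RHS]big_ord_recr /= [X in _ + X](_ : _ = 0) ?addr0 //.
  by rewrite /G qbin_small // !mul0r.
rewrite big_ord_recl [in RHS]big_ord_recl -addrA; congr (_ + _).
  congr (_ * _ * _); rewrite /G /unity_coef /= !qbin0 !expr0 !subn0 (qpochS t).
  move: t1 tN sN s1; rewrite (qpochS s) => t1.
  move: (qpoch t _ _) (qpoch s _ _) => T S T0 S0 s1.
  rewrite /qpoch big_ord0; field; rewrite s1 S0 T0 /=.
  by rewrite t1.
rewrite -sumrB; apply: eq_bigr => l _.
have lN : (l <= N)%N by rewrite -ltnS.
rewrite /= /bump /= add1n subSS raise // /P /Q.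
by rewrite !mulrBl.
Qed.

Lemma phi_bernstein a b q z j n : (j <= n)%N -> a != 0 -> b != 0 -> q != 0 ->
    z != 0 -> qpoch (a * q ^+ j * b) q (n - j) != 0 ->
    qpoch (b / (a * q ^+ j)) q (n - j).+1 != 0 ->
    qpoch (q / (b / (a * q ^+ j))) q (n - j) != 0 ->
  phi j z a q = \sum_(j <= k < n.+1)
    unity_coef q (a * q ^+ j * b) (b / (a * q ^+ j)) (n - j) (k - j)
    * phi k z a q * phi (n - k) z b q.
Proof.
move=> jn a0 b0 q0 z0 h1 h2 h3.
have aj0 : a * q ^+ j != 0 by rewrite mulf_neq0 ?expf_neq0.
have shift (F : nat -> K) :
    \sum_(j <= k < n.+1) F k = \sum_(l < (n - j).+1) F (l + j)%N.
  by rewrite -{1}[j]add0n big_addn subSn // big_mkord.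
rewrite shift -[LHS]mulr1 -(partition_of_unity aj0 b0 z0 h1 h2 h3) mulr_sumr.
apply: eq_bigr => l _; rewrite addnK [in RHS]addnC phiD subnDA.
by ring.
Qed.

Definition aw_coef m j a b c d q : K :=
  a ^- m * qpochs [:: a * b; a * c; a * d] q m *
  (qpochs [:: q ^- m; a * b * c * d * q ^ (m%:Z - 1)] q j
   / qpochs [:: q; a * b; a * c; a * d] q j * q ^+ j).

Lemma askey_wilson_phi m z a b c d q : askey_wilson m z a b c d q =
  \sum_(j < m.+1) aw_coef m j a b c d q * phi j z a q.
Proof.
rewrite /askey_wilson mulr_sumr; apply: eq_bigr => j _.
rewrite /aw_coef phiE {2}/qpochs !big_cons big_nil.
rewrite -!mulrA; congr (_ * (_ * _)).
rewrite /qpochs !big_cons !big_nil !invfM; ring.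
Qed.

(** The expansion of [phi j] involves only indices [k >= j], hence the bound [minn m k]; the inverse
    binomial cancels the one built into [qbernstein]. *)
Definition conn_coef n m k a b c d q : K :=
  'C(n, k)%:R^-1 * \sum_(j < (minn m k).+1) aw_coef m j a b c d q *
    unity_coef q (a * q ^+ j * b) (b / (a * q ^+ j)) (n - j) (k - j).

Lemma askey_wilson_bernstein n m z a b c d q : (m <= n)%N ->
    (forall k, (k <= n)%N -> 'C(n, k)%:R != 0 :> K) ->
    a != 0 -> b != 0 -> q != 0 -> z != 0 ->
    (forall j, (j <= n)%N -> [/\ qpoch (a * q ^+ j * b) q (n - j) != 0,
      qpoch (b / (a * q ^+ j)) q (n - j).+1 != 0 &
      qpoch (q / (b / (a * q ^+ j))) q (n - j) != 0]) ->
  askey_wilson m z a b c d q =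
  \sum_(k < n.+1) conn_coef n m k a b c d q * qbernstein n k z a b q.
Proof.
move=> mn C0 a0 b0 q0 z0 h; rewrite askey_wilson_phi.
pose F j k := aw_coef m j a b c d q *
    unity_coef q (a * q ^+ j * b) (b / (a * q ^+ j)) (n - j) (k - j) *
    phi k z a q * phi (n - k) z b q.
transitivity (\sum_(j < m.+1) \sum_(k < n.+1 | (j <= k)%N) F j k).
  apply: eq_bigr => j _.
  have jn : (j <= n)%N by apply: leq_trans mn; rewrite -ltnS.
  have [h1 h2 h3] := h _ jn.
  rewrite {1}(phi_bernstein jn a0 b0 q0 z0 h1 h2 h3) big_geq_mkord mulr_sumr.
  by apply: eq_bigr => k _; rewrite /F !mulrA.
rewrite (exchange_big_dep xpredT) //=; apply: eq_bigr => k _.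
have kn : (k <= n)%N by rewrite -ltnS.
rewrite /conn_coef /qbernstein -!mulrA [X in _ = _ * X]mulrCA mulKf ?C0 //.
rewrite mulr_suml (big_ord_widen_cond m.+1 xpredT (fun j => aw_coef m j a b c d q *
    unity_coef q (a * q ^+ j * b) (b / (a * q ^+ j)) (n - j) (k - j) *
    (phi k z a q * phi (n - k) z b q))) ?ltnS ?geq_minl //.
apply: eq_big => [j|j _]; last by rewrite /F -!mulrA.
by rewrite /= ltnS leq_min -(ltnS j m) ltn_ord.
Qed.

(** The system is triangular: at [z = (b * q ^+ i)^-1] the symbol [qpoch (b * z) q (n - j)] contains
    the factor [1 - q ^- i * q ^+ i] once [i < n - j]. So the terms with [j < n - i] vanish, those
    with [j > n - i] are removed by induction, and the four inequalities keep the surviving [phi]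
    factors nonzero. *)
Lemma qbernstein_free n a b q (f : nat -> K) :
    (forall k, (k <= n)%N -> 'C(n, k)%:R != 0 :> K) ->
    b != 0 -> q != 0 ->
    (forall i, (i <= n)%N -> [/\ qpoch (q ^- i) q i != 0,
      qpoch (b * (b * q ^+ i)) q i != 0,
      qpoch (a / (b * q ^+ i)) q (n - i) != 0 &
      qpoch (a * (b * q ^+ i)) q (n - i) != 0]) ->
    (forall z, z != 0 -> \sum_(k < n.+1) f k * qbernstein n k z a b q = 0) ->
  forall k, (k <= n)%N -> f k = 0.
Proof.
move=> C0 b0 q0 h fz k kn.
suff H i : (i <= n)%N -> f (n - i)%N = 0.
  by rewrite -(subKn kn) H // leq_subr.
elim/ltn_ind: i => i IH in_.
have [h1 h2 h3 h4] := h i in_.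
have z0 : (b * q ^+ i)^-1 != 0 by rewrite invr_neq0 ?mulf_neq0 ?expf_neq0.
have lt : (n - i < n.+1)%N by rewrite ltnS leq_subr.
have := fz _ z0; rewrite (bigD1 (Ordinal lt)) //= big1 ?addr0; last first.
  move=> j; rewrite -val_eqE /= => ji; case: (ltnP j (n - i)) => jn.
    rewrite /qbernstein [phi (n - j) _ _ _]phiE.
    have -> : b / (b * q ^+ i) = q ^- i by field; rewrite b0 expf_neq0.
    have ij : (i < n - j)%N by rewrite ltn_subRL addnC -ltn_subRL.
    rewrite [qpoch (q ^- i) _ _](bigD1 (Ordinal ij)) //=.
    by rewrite mulVf ?expf_neq0 // subrr !mul0r !mulr0.
  have jn' : (j <= n)%N by rewrite -ltnS.
  have := IH (n - j)%N; rewrite subKn // => -> //; rewrite ?mul0r ?leq_subr //.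
  by rewrite ltn_subLR // addnC -ltn_subLR // ltn_neqAle eq_sym ji.
move/eqP; rewrite mulf_eq0 => /orP[/eqP //|].
rewrite /qbernstein !phiE subKn // invrK.
have -> : b / (b * q ^+ i) = q ^- i by field; rewrite b0 expf_neq0.
by rewrite !mulf_eq0 !(negbTE (C0 _ _)) ?leq_subr // (negbTE h1) (negbTE h2)
  (negbTE h3) (negbTE h4).
Qed.

End QBernstein.

(** * Limits along q -> 1 *)

Section ComplexPowers.
Variable R : realType.
Implicit Types (q : R) (w : R[i]).

Lemma cpowD q w1 w2 : cpow q (w1 + w2) = cpow q w1 * cpow q w2.
Proof.
case: w1 w2 => [a b] [c d]; rewrite /cpow /= !mulrDl expRD cosD sinD.
by apply/eqP; rewrite eq_complex /=; apply/andP; split; apply/eqP; ring.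
Qed.

Lemma cpow0 q : cpow q 0 = 1.
Proof.
rewrite /cpow /= !mul0r expR0 cos0 sin0.
by apply/eqP; rewrite eq_complex /=; apply/andP; split; apply/eqP; ring.
Qed.

Lemma cpow_neq0 q w : cpow q w != 0.
Proof.
apply/eqP => w0; have := cpow0 q; rewrite -(subrr w) cpowD w0 mul0r.
by move/esym/eqP; rewrite oner_eq0.
Qed.

Lemma cpowN q w : cpow q (- w) = (cpow q w)^-1.
Proof.
by apply: (mulIf (cpow_neq0 q w)); rewrite -cpowD addNr cpow0 mulVf ?cpow_neq0.
Qed.

Lemma cpow1 q : 0 < q -> cpow q 1 = q%:C.
Proof.
move=> q0; rewrite /cpow /= mul1r mul0r lnK ?posrE // cos0 sin0.
by apply/eqP; rewrite eq_complex /=; apply/andP; split; apply/eqP; ring.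
Qed.

Lemma cpow_nat q (j : nat) : 0 < q -> cpow q j%:R = q%:C ^+ j.
Proof.
move=> q0; elim: j => [|j IH]; first by rewrite cpow0 expr0.
by rewrite -addn1 natrD cpowD IH cpow1 // exprD expr1.
Qed.

(** The norm is at most the sum of the absolute values of the real and imaginary parts, so half the
    radius for each suffices. *)
Lemma cvg_complex (T : Type) (F : set_system T) {FF : Filter F} (f g : T -> R)
    (a b : R) : f x @[x --> F] --> a -> g x @[x --> F] --> b ->
  (f x +i* g x) @[x --> F] --> ((a +i* b) : R[i]^o).
Proof.
move=> fa gb; apply/(@cvgrPdist_lt R[i] R[i]^o) => e e0.
(* A positive element of [R[i]] has zero imaginary part, so the radius is real. *)
have [r -> r0] : exists2 r, e = r%:C & 0 < r.
  move: e0; rewrite ltcE /= => /andP[/eqP e0 r0].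
  exists (complex.Re e) => //; apply/eqP; rewrite eq_complex /= eqxx.
  by rewrite -e0 eqxx.
have r2 : 0 < r / 2 by rewrite divr_gt0.
move/cvgrPdist_lt: fa => /(_ _ r2) fa.
move/cvgrPdist_lt: gb => /(_ _ r2) gb.
near=> x.
have -> : (a +i* b - (f x +i* g x) : R[i]) = (a - f x)%:C + 'i%C * (b - g x)%:C.
  by apply/eqP; rewrite eq_complex /=; apply/andP; split; apply/eqP; ring.
apply: le_lt_trans (ler_normD _ _) _; rewrite normrM.
have -> : `|'i%C : R[i]| = 1.
  by rewrite normc_def /= expr0n expr1n add0r sqrtr1.
rewrite mul1r !normc_def /= expr0n /= !addr0 !sqrtr_sqr -rmorphD ltcR.
rewrite [ltRHS]splitr ltrD //; near: x; assumption.
Unshelve. all: by end_near. Qed.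

(** The limit is the derivative of [q ^ w] at [q = 1], computed on real and imaginary parts. *)
Lemma cvg_one_sub_cpow w :
  (1 - q)%:C^-1 * (1 - cpow q w) @[q --> (1 : R)^'-] --> (w : R[i]^o).
Proof.
case: w => u v.
pose f (q : R) := expR (u * ln q) * cos (v * ln q).
pose g (q : R) := expR (u * ln q) * sin (v * ln q).
have ln1' : is_derive (1 : R) 1 (@ln R) 1.
  by apply: (is_derive_eq (is_derive1_ln ltr01)); rewrite invr1.
have du (c : R) : is_derive (1 : R) 1 (fun q => c * ln q) c.
  by apply: (is_derive_eq (is_deriveZ c ln1')); rewrite /GRing.scale /= mulr1.
have df : is_derive (1 : R) 1 f u.
  have d1 := is_derive1_comp (g := fun q => u * ln q)
    (is_derive_expR (u * ln 1)) (du u).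
  have d2 := is_derive1_comp (g := fun q => v * ln q)
    (is_derive_cos (v * ln 1)) (du v).
  apply: (is_derive_eq (is_deriveM d1 d2)); rewrite /GRing.scale /=.
  by rewrite ln1 !mulr0 expR0 cos0 sin0; ring.
have dg : is_derive (1 : R) 1 g v.
  have d1 := is_derive1_comp (g := fun q => u * ln q)
    (is_derive_expR (u * ln 1)) (du u).
  have d2 := is_derive1_comp (g := fun q => v * ln q)
    (is_derive_sin (v * ln 1)) (du v).
  apply: (is_derive_eq (is_deriveM d1 d2)); rewrite /GRing.scale /=.
  by rewrite ln1 !mulr0 expR0 cos0 sin0; ring.
(* Caratheodory's form of the derivative: [f q - f 1 = f' q * (q - 1)] with [f'] continuous at 1, so
   the difference quotient tends to [f' 1]. *)
have [f' [fE cf f1]] := (is_derive1_caratheodory f 1 u).1 df.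
have [g' [gE cg g1]] := (is_derive1_caratheodory g 1 v).1 dg.
apply: cvg_trans; last first.
  apply: (cvg_complex (F := (1 : R)^'-)); apply: cvg_at_left_filter;
  [rewrite -f1; exact: cf | rewrite -g1; exact: cg].
apply: near_eq_cvg; near=> q.
have q1 : (1 - q)%:C != 0 :> R[i].
  rewrite eq_complex /= eqxx andbT subr_eq0 eq_sym.
  by near: q; exact: nbhs_left_neq.
apply: (mulfI q1); rewrite mulrA divff // mul1r.
have := fE q; have := gE q; rewrite /f /g ln1 !mulr0 expR0 cos0 sin0.
rewrite mulr0 mulr1 subr0 => gq fq.
apply/eqP; rewrite eq_complex /cpow /=; apply/andP; split; apply/eqP.
  rewrite !mul0r !subr0; have -> : (1 - q) * f' q = - (f' q * (q - 1)) by ring.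
  by rewrite -fq; ring.
rewrite !mul0r !addr0; have -> : (1 - q) * g' q = - (g' q * (q - 1)) by ring.
by rewrite -gq; ring.
Unshelve. all: by end_near. Qed.

End ComplexPowers.

(** * A calculus of leading orders in powers of [1 - q] *)

Section Asymptotics.
Variable R : realType.
Implicit Types (p : int) (f g : R -> R[i]) (l w : R[i]) (j k m n N : nat).

(* f q = (1 - q) ^ p * (l + o(1)); a record, so that unification does not unfold
   the limit. *)
Record asym p f l : Prop := Asym {
  asym_cvg : (1 - q)%:C ^ (- p) * f q @[q --> (1 : R)^'-] --> (l : R[i]^o) }.

Lemma near1 : \forall q \near (1 : R)^'-, 0 < q < 1.
Proof.
near=> q; apply/andP; split; near: q; last exact: nbhs_left_lt.
exact: nbhs_left_gt ltr01.
Unshelve. all: by end_near. Qed.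

Lemma subC_neq0 (q : R) : 0 < q < 1 -> (1 - q)%:C != 0 :> R[i].
Proof.
case/andP=> _ q1; rewrite eq_complex /= eqxx andbT subr_eq0 eq_sym.
by rewrite (lt_eqF q1).
Qed.

Lemma asym_near p f g l : (\forall q \near (1 : R)^'-, f q = g q) ->
  asym p f l -> asym p g l.
Proof.
move=> fg [fl]; split; apply: cvg_trans fl; apply: near_eq_cvg.
by apply: filterS fg => q ->.
Qed.

(** Closes most asymptotic computations: the other rules yield a function, an exponent and a limit
    in their own shape, and each is then matched separately. *)
Lemma asym_eq p p' f g l l' : asym p f l ->
  (forall q, 0 < q < 1 -> f q = g q) -> p = p' -> l = l' -> asym p' g l'.
Proof.
move=> fl fg <- <-; apply: asym_near fl; apply: filterS near1 => q; exact: fg.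
Qed.

Lemma asymM p p' f g l l' :
  asym p f l -> asym p' g l' -> asym (p + p') (fun q => f q * g q) (l * l').
Proof.
move=> [fl] [gl]; split; apply: cvg_trans; last exact: (cvgM fl gl).
apply: near_eq_cvg; apply: filterS near1 => q q1 /=.
by rewrite opprD expfzDr ?subC_neq0 // mulrACA.
Qed.

Lemma asymV p f l : l != 0 -> asym p f l -> asym (- p) (fun q => (f q)^-1) l^-1.
Proof.
move=> l0 [fl]; split; apply: cvg_trans; last exact: (cvgV l0 fl).
apply: near_eq_cvg; apply: filterS near1 => q q1 /=.
by rewrite invfM invr_expz.
Qed.

Lemma asym_div p p' f g l l' : l' != 0 ->
  asym p f l -> asym p' g l' -> asym (p - p') (fun q => f q / g q) (l / l').
Proof. by move=> l0 fl gl; exact: asymM fl (asymV l0 gl). Qed.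

Lemma asym_sum (I : finType) (P : pred I) p (f : I -> R -> R[i])
    (l : I -> R[i]) :
  (forall i, P i -> asym p (f i) (l i)) ->
  asym p (fun q => \sum_(i | P i) f i q) (\sum_(i | P i) l i).
Proof.
move=> fl; split; under eq_fun do rewrite mulr_sumr.
apply: (@cvg_big R[i]^o I +%R 0 P); last by move=> j /fl[].
  exact: add_continuous.
Qed.

Lemma asym_cst l : asym 0 (fun=> l) l.
Proof.
split; under eq_fun do rewrite oppr0 expr0z mul1r.
exact: (@cvg_cst R[i]^o).
Qed.

(** Transfers the nonvanishing of limit denominators to the q-denominators. *)
Lemma asym_neq0 p f l : l != 0 -> asym p f l ->
  \forall q \near (1 : R)^'-, f q != 0.
Proof.
move=> l0 [fl]; near=> q.
have : (1 - q)%:C ^ (- p) * f q != 0.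
  by near: q; exact: (cvgr_neq0 (V := R[i]^o) l fl l0).
by rewrite mulf_eq0 => /norP[].
Unshelve. all: by end_near. Qed.

Lemma asym_one_sub_cpow w : asym 1 (fun q => 1 - cpow q w) w.
Proof. by split; exact: cvg_one_sub_cpow. Qed.

(** The spare power of [1 - q] sends the product to [l * 0]. *)
Lemma asym_vanish f l : asym 1 f l -> asym 0 f 0.
Proof.
move=> [fl]; split.
have c0 : (1 - q)%:C @[q --> (1 : R)^'-] --> (0 : R[i]^o).
  apply: (cvg_complex (F := (1 : R)^'-) (f := fun q => 1 - q) (g := fun=> 0));
    last exact: cvg_cst.
  rewrite -(subrr 1); apply: cvgB; first exact: cvg_cst.
  exact: cvg_at_left_filter.
rewrite -[X in _ --> X](mulr0 l); apply: cvg_trans; last exact: (cvgM fl c0).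
apply: near_eq_cvg.
apply: filterS near1 => q q1 /=.
by rewrite mulrAC oppr0 expr0z mul1r mulVf ?subC_neq0 ?mul1r.
Qed.

Lemma asymN p f l : asym p f l -> asym p (fun q => - f q) (- l).
Proof.
move=> fl; refine (asym_eq (asymM (asym_cst (-1)) fl) _ (add0r _) _) => [q _|];
exact: mulN1r.
Qed.

Lemma asymD p f g l l' :
  asym p f l -> asym p g l' -> asym p (fun q => f q + g q) (l + l').
Proof.
move=> [fl] [gl]; split; under eq_fun do rewrite mulrDr.
exact: (@cvgD R[i] R[i]^o R (1 : R)^'- _ _ _ _ _ fl gl).
Qed.

(** Write [q ^ w = 1 - (1 - q ^ w)], where the bracket tends to 0. *)
Lemma asym_cpow w : asym 0 (fun q => cpow q w) 1.
Proof.
have h := asymN (asym_vanish (asym_one_sub_cpow w)).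
refine (asym_eq (asymD (asym_cst 1) h) _ erefl _) => [q _|].
  by rewrite opprB subrKC.
by rewrite oppr0 addr0.
Qed.

(** Each factor [1 - q ^ (w + j)] contributes one power of [1 - q] and the limit [w + j]. *)
Lemma asym_qpoch w k :
  asym k%:Z (fun q => qpoch (cpow q w) q%:C k) (rising w k).
Proof.
elim: k => [|k IH].
  refine (asym_eq (asym_cst 1) _ erefl _) => [q _|];
  by rewrite /qpoch /rising big_ord0.
refine (asym_eq (asymM IH (asym_one_sub_cpow (w + k%:R))) _ _ _).
- by move=> q /andP[q0 _]; rewrite qpochS cpowD cpow_nat.
- by rewrite -natz natr1 natz.
- by rewrite risingS.
Qed.

(** In the limit the q-Pascal rule becomes the Pascal rule. *)
Lemma asym_qbin N (l : nat) : asym 0 (fun q => qbin q%:C N l) 'C(N, l)%:R.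
Proof.
have c1 := asym_cst (1 : R[i]).
elim: N l => [|N IH] [|l].
- exact: asym_cst.
- exact: asym_cst.
- exact: asym_cst.
rewrite binS natrD; refine (asymD _ (IH l)).
refine (asym_eq (asymM (asym_cpow l.+1%:R) (IH l.+1)) _ _ _).
- by move=> q /andP[q0 _]; rewrite cpow_nat.
- by [].
- by rewrite mul1r.
Qed.

(** Order count: the numerator has order 1, the three symbols below it have orders [N], [N - l + 1]
    and [l], which leaves [1 - (2 N + 1)]. *)
Lemma asym_unity_coef (s t : R[i]) N (l : nat) : (l <= N)%N ->
    rising s N != 0 -> rising t (N - l).+1 != 0 -> rising (1 - t) l != 0 ->
  asym (- (2 * N)%:Z) (fun q => unity_coef q%:C (cpow q s) (cpow q t) N l)
    ('C(N, l)%:R * (t + N%:R - 2 * l%:R) /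
     (rising s N * rising t (N - l).+1 * rising (1 - t) l)).
Proof.
move=> lN s0 t0 u0.
have n0 : asym 1 (fun q => q%:C ^+ l - cpow q t * q%:C ^+ (N - l))
    (t + N%:R - 2 * l%:R).
  (* The numerator is factored as [q ^ l] times [1 - q ^ (t + N - 2 l)]. *)
  refine (asym_eq (asymM (asym_cpow l%:R)
    (asym_one_sub_cpow (t + (N - l)%:R - l%:R))) _ _ _) => [q /andP[q0 _]| |].
  - by rewrite mulrBr mulr1 -cpowD (addrC l%:R) subrK cpowD !cpow_nat.
  - by [].
  - by rewrite mul1r natrB //; ring.
have d0 := asymM (asymM (asym_qpoch s N) (asym_qpoch t (N - l).+1))
  (asym_qpoch (1 - t) l).
refine (asym_eq (asym_div _ (asymM (asym_qbin N l) n0) d0) _ _ erefl).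
- by rewrite !mulf_neq0.
- by move=> q /andP[q0 _]; rewrite /unity_coef cpowD cpowN cpow1.
- rewrite add0r -!natz -natrD -natrD.
  have -> : (N + (N - l).+1 + l = (2 * N).+1)%N.
    by rewrite -addnA addSn subnK // addnS mul2n addnn.
  by rewrite -natr1 opprD addrCA subrr addr0.
Qed.

End Asymptotics.

(** * The limit coefficients *)

Section Rising.
Variable K : fieldType.
Implicit Types (c d : K) (j k n : nat).

Lemma rising1 j : rising (1 : K) j = j`!%:R.
Proof.
elim: j => [|j IH]; first by rewrite /rising big_ord0.
by rewrite risingS IH factS natrM mulrC -natr1 addrC.
Qed.

(** Reverse the order of the factors and extract a sign from each. *)
Lemma rising_reflect c j : rising (- c) j = (-1) ^+ j * rising (c - j%:R + 1) j.
Proof.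
rewrite /rising (reindex_inj rev_ord_inj) /=.
transitivity (\prod_(i < j) - (c - j%:R + 1 + i%:R)).
  by apply: eq_bigr => i _; rewrite natrB // -natr1; ring.
by rewrite prodrN card_ord.
Qed.

(** Induction on [j] by the absorption rule for binomials. This is the source of the entries [- k]
    and [- n] of the Racah series. *)
Lemma bin_rising n k j : (j <= k)%N -> (k <= n)%N ->
  'C(n - j, k - j)%:R * rising (- n%:R : K) j = 'C(n, k)%:R * rising (- k%:R) j.
Proof.
move=> jk kn; elim: j jk => [|j IH] jk.
  by rewrite !subn0 /rising !big_ord0.
have jn : (j < n)%N := leq_trans jk kn.
rewrite !risingS [RHS]mulrA -IH 1?ltnW //.
have := mul_bin_diag (n - j) (k - j.+1); rewrite subnSK // -subnS.
move/(congr1 (fun x : nat => x%:R : K)); rewrite !natrM (natrB _ (ltnW jn)).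
rewrite (natrB _ (ltnW jk)) => h.
have -> : - n%:R + j%:R = - (n%:R - j%:R) :> K by ring.
have -> : - k%:R + j%:R = - (k%:R - j%:R) :> K by ring.
rewrite [LHS](_ : _ = - rising (- n%:R) j * ((n%:R - j%:R) *
  'C(n - j.+1, k - j.+1)%:R)); last by ring.
by rewrite h; ring.
Qed.

(** Split [(d - j)_(r + 1 + j)] after [j] and after [r + 1] factors; the reflections of [(1 - d)_j]
    and [(- d - r)_j] carry the same sign. With [d = B - A] and [r = n - k] the extracted factor is
    the Racah numerator [(A - B + k - n)_j]. *)
Lemma rising_shift d r j k : (j <= k)%N ->
  rising (d - j%:R) r.+1 * rising (1 - d + j%:R) (k - j) * rising (- d - r%:R) j
  = rising d r.+1 * rising (1 - d) k.
Proof.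
move=> jk; have := rising_reflect (d - 1) j.
have -> : d - 1 - j%:R + 1 = d - j%:R by ring.
have -> : - (d - 1) = 1 - d by ring.
move=> h1; rewrite -{2}(subnKC jk) risingD h1 -opprD rising_reflect.
have := risingD (d - j%:R) j r.+1; rewrite subrK addnC risingD.
have -> : d - j%:R + r.+1%:R = d + r%:R - j%:R + 1 by rewrite -natr1; ring.
set v := rising (d + r%:R - j%:R + 1) j => e.
rewrite [LHS](_ : _ = (rising (d - j%:R) r.+1 * v) *
  ((-1) ^+ j * rising (1 - d + j%:R) (k - j))); last by ring.
by rewrite e; ring.
Qed.

End Rising.

(** * Limits of the Askey-Wilson coefficients and their Racah form *)

Section Limits.
Variable R : realType.
Implicit Types (A B C D X w : R[i]) (j k m n N : nat).

Lemma cpowX (q : R) w k : cpow q w ^+ k = cpow q (w *+ k).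
Proof.
elim: k => [|k IH]; first by rewrite mulr0n cpow0.
by rewrite exprS IH mulrS cpowD.
Qed.

Lemma asym_phi k X A : asym (2 * k)%:Z
  (fun q => phi k (cpow q ('i%C * X)) (cpow q A) q%:C) (rho k X A).
Proof.
refine (asym_eq (asymM (asym_qpoch (A + 'i%C * X) k)
  (asym_qpoch (A - 'i%C * X) k)) _ _ erefl).
- by move=> q _; rewrite phiE !cpowD cpowN.
- by rewrite mul2n -addnn PoszD.
Qed.

Definition wilson_coef m j A B C D : R[i] := omegabar m A B C D *
  (rising (- m%:R) j * rising (A + B + C + D + m%:R - 1) j /
   (rising (A + B) j * rising (A + C) j * rising (A + D) j * j`!%:R)).

Lemma wilson_rho m X A B C D : wilson m X A B C D =
  \sum_(j < m.+1) wilson_coef m j A B C D * rho j X A.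
Proof.
rewrite /wilson /hypergeom mulr_sumr; apply: eq_bigr => j _.
rewrite /wilson_coef /omegabar /rho !big_cons !big_nil !mulr1 -!mulrA.
do 3! congr (_ * _); rewrite !invfM; ring.
Qed.

(** Order count: [3 m] from the prefactor, [2 j] from the numerator symbols, [- 4 j] from the
    denominator symbols, among them [(q; q)_j] with limit [j!]; the pure powers of [a] and [q] tend
    to 1. *)
Lemma asym_aw_coef m j A B C D :
    rising (A + B) j != 0 -> rising (A + C) j != 0 -> rising (A + D) j != 0 ->
  asym ((3 * m)%:Z - (2 * j)%:Z)
    (fun q => aw_coef m j (cpow q A) (cpow q B) (cpow q C) (cpow q D) q%:C)
    (wilson_coef m j A B C D).
Proof.
move=> b0 c0 d0.
have h1 := asymM (asymM (asym_cpow (- (A *+ m))) (asymM (asym_qpoch (A + B) m)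
  (asym_qpoch (A + C) m))) (asym_qpoch (A + D) m).
have h2 := asymM (asym_qpoch (- m%:R) j)
  (asym_qpoch (A + B + C + D + m%:R - 1) j).
have h3 := asymM (asymM (asym_qpoch (A + B) j) (asym_qpoch (A + C) j))
  (asymM (asym_qpoch (A + D) j) (asym_qpoch 1 j)).
have j0 : rising (1 : R[i]) j != 0.
  by rewrite rising1 pnatr_eq0 -lt0n fact_gt0.
have n0 := mulf_neq0 (mulf_neq0 b0 c0) (mulf_neq0 d0 j0).
have h4 := asymM h1 (asymM (asym_div n0 h2 h3) (asym_cpow j%:R)).
refine (asym_eq h4 _ _ _).
- move=> q /andP[q0 q1]; rewrite /aw_coef /qpochs !big_cons !big_nil !mulr1.
  have qC : q%:C != 0 :> R[i].
    by rewrite eq_complex /= eqxx andbT (gt_eqF q0).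
  rewrite expfzDr // !cpowD !cpowN cpow_nat // cpow1 // cpow_nat // cpowX.
  rewrite -(mulrA _ (q%:C ^+ m)).
  move: (cpow q A) (cpow q B) (cpow q C) (cpow q D) => a b c d.
  by rewrite !invfM; ring.
- rewrite -!natz !natrM; ring.
- rewrite /wilson_coef /omegabar rising1 mul1r mulr1 !mulrA.
  by [].
Qed.

Lemma pibarE n k A B : (k <= n)%N -> pibar n k A B =
  (B - A + n%:R - 2 * k%:R) /
  (rising (A + B) n * rising (B - A) (n - k).+1 * rising (A - B + 1) k).
Proof. by move=> kn; rewrite /pibar risingS mulrA. Qed.

(** Isolates the dependence on [j]: [(A + B)_j] completes the shifted symbol to [(A + B)_n],
    [bin_rising] treats the binomial, [rising_shift] the two symbols in [B - A], and the linear
    numerator does not depend on [j]. *)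
Lemma unity_limit_racah n j k A B : (j <= k)%N -> (k <= n)%N ->
    rising (B - A) (n - k).+1 != 0 -> rising (A - B + 1) k != 0 ->
    rising (B - (A + j%:R)) (n - k).+1 != 0 ->
    rising (1 - (B - (A + j%:R))) (k - j) != 0 ->
  'C(n - j, k - j)%:R *
    (B - (A + j%:R) + (n - j)%:R - 2 * (k - j)%:R) /
    (rising (A + j%:R + B) (n - j) * rising (B - (A + j%:R)) (n - k).+1
     * rising (1 - (B - (A + j%:R))) (k - j)) / rising (A + B) j
  = 'C(n, k)%:R * pibar n k A B *
    (rising (- k%:R) j * rising (A - B + k%:R - n%:R) j / rising (- n%:R) j).
Proof.
move=> jk kn; have jn := leq_trans jk kn; rewrite (pibarE _ _ kn).
have -> : A + j%:R + B = A + B + j%:R by ring.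
have -> : A - B + k%:R - n%:R = - (B - A) - (n - k)%:R.
  by rewrite natrB //; ring.
have -> : B - (A + j%:R) = B - A - j%:R by ring.
have -> : 1 - (B - A - j%:R) = 1 - (B - A) + j%:R by ring.
have -> : A - B + 1 = 1 - (B - A) by ring.
have -> : B - A - j%:R + (n - j)%:R - 2 * (k - j)%:R = B - A + n%:R - 2 * k%:R.
  by rewrite !natrB //; ring.
have sh := rising_shift (B - A) (n - k) jk.
have n0 : rising (- n%:R : R[i]) j != 0.
  apply: rising_neq0 => i ij; rewrite addrC subr_eq0 eqr_nat.
  by rewrite (ltn_eqF (leq_trans ij jn)).
have bn := bin_rising R[i] jk kn.
rewrite -[in rising (A + B) n](subnKC jn) risingD.
move: (rising (A + B) j) (rising (A + B + _) _) => p p'.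
move: bn n0 sh; move: (_ - 2 * k%:R) ('C(_, _)%:R) ('C(_, _)%:R) => e c c'.
move: (rising (- n%:R) j) (rising (- k%:R) j) => x y bn x0.
move: (rising _ (n - k).+1) (rising _ (k - j)) (rising _ j) (rising _ (n - k).+1)
  (rising _ k) => u v w g h sh u0 v0 g0 h0.
have -> : c' = c * y / x by rewrite -bn mulfK.
have -> : w = u * h / (g * v) by rewrite -sh; field; rewrite g0 h0.
by rewrite !invfM; move: p^-1 p'^-1 => {}p {}p'; field; rewrite u0 v0 g0 h0 x0.
Qed.

Lemma near_qpoch w k : rising w k != 0 ->
  \forall q \near (1 : R)^'-, qpoch (cpow q w) q%:C k != 0.
Proof. by move=> w0; exact: asym_neq0 w0 (asym_qpoch w k). Qed.

(** * Nonvanishing of denominators from genericity *)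

Section Generic.
Variables (n : nat) (A B C D : R[i]).
Hypotheses (hn : (1 <= n)%N) (hgen : generic n A B C D).

(** The integer [y - x] lies in the range excluded for [A - B]. *)
Lemma generic_diff x y : (x <= n.+1)%N -> (y <= n.+1)%N ->
  A - B + x%:R - y%:R != 0.
Proof.
case: hgen => h _ _ _ xn yn.
have /h : - n.+1%:Z <= y%:Z - x%:Z <= n.+1%:Z.
  apply/andP; split.
    by rewrite lerNl opprB lerBlDr (le_trans (_ : _ <= n.+1%:Z)) ?lerDl ?lez_nat.
  by rewrite lerBlDr (le_trans (_ : _ <= n.+1%:Z)) ?lerDl ?lez_nat.
apply: contra_neq => /eqP; rewrite -addrA addr_eq0 => /eqP ->.
by rewrite opprB intrB.
Qed.

Lemma generic_rising s i k : s \in [:: A + B; A + C; A + D; B + C; B + D] ->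
  (i + k <= n)%N -> rising (s + i%:R) k != 0.
Proof.
case: hgen => _ h _ _ sin ik; apply: rising_neq0 => j jk.
rewrite -addrA -natrD addr_eq0; apply: h => //.
by rewrite -ltnS prednK // (leq_trans _ ik) // -addnS leq_add2l.
Qed.

(** The factors are [2 * B + (i + j)] with [i + j <= 2 n - 1]; genericity does not exclude
    [2 * B = 0], hence [1 <= i]. *)
Lemma generic_double i k : (1 <= i)%N -> (i + k <= 2 * n)%N ->
  rising (B + (B + i%:R)) k != 0.
Proof.
case: hgen => _ _ h _ i1 ik; apply: rising_neq0 => j jk.
have -> : B + (B + i%:R) + j%:R = 2 * B + (i + j)%:R by rewrite natrD; ring.
rewrite addr_eq0; apply: h; rewrite ?inE ?eqxx ?orbT // ltn_addr //=.
by rewrite -ltnS prednK ?muln_gt0 // (leq_trans _ ik) // -addnS leq_add2l.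
Qed.

Lemma generic_diffl j k : (j <= n)%N -> (k <= (n - j).+1)%N ->
  rising (B - (A + j%:R)) k != 0.
Proof.
move=> jn kj; apply: rising_neq0 => i ik; rewrite -oppr_eq0.
have -> : - (B - (A + j%:R) + i%:R) = A - B + j%:R - i%:R by ring.
apply: generic_diff; first by rewrite ltnW.
by rewrite (leq_trans (ltnW ik)) // (leq_trans kj) // ltnS leq_subr.
Qed.

Lemma generic_diffr j k : (j + k <= n)%N ->
  rising (1 - (B - (A + j%:R))) k != 0.
Proof.
move=> jk; apply: rising_neq0 => i ik.
have -> : 1 - (B - (A + j%:R)) + i%:R = A - B + (j + i).+1%:R - 0%:R.
  by rewrite -natr1 natrD; ring.
apply: generic_diff => //; rewrite ltnS (leq_trans _ jk) // leq_add2l.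
exact: ltnW.
Qed.

(** Supplies the hypothesis of [askey_wilson_bernstein]. Finitely many [j] allow one common
    neighbourhood; every base is first written as a single power [cpow q w], so that [near_qpoch]
    applies. *)
Lemma near_unity_denom : \forall q \near (1 : R)^'-, forall j, (j <= n)%N ->
  let a := cpow q A in let b := cpow q B in
  [/\ qpoch (a * q%:C ^+ j * b) q%:C (n - j) != 0,
      qpoch (b / (a * q%:C ^+ j)) q%:C (n - j).+1 != 0 &
      qpoch (q%:C / (b / (a * q%:C ^+ j))) q%:C (n - j) != 0].
Proof.
have : \forall q \near (1 : R)^'-, forall j : 'I_n.+1,
  [/\ qpoch (cpow q (A + B + j%:R)) q%:C (n - j) != 0,
      qpoch (cpow q (B - (A + j%:R))) q%:C (n - j).+1 != 0 &
      qpoch (cpow q (1 - (B - (A + j%:R)))) q%:C (n - j) != 0].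
  apply: filter_forall => j; have jn : (j <= n)%N by rewrite -ltnS.
  near=> q; split; near: q; apply: near_qpoch.
  - by apply: generic_rising; rewrite ?inE ?eqxx // subnKC.
  - exact: generic_diffl.
  - by apply: generic_diffr; rewrite subnKC.
move=> h; near=> q => j jn a b.
have /andP[q0 _] : 0 < q < 1 by near: q; exact: near1.
have /(_ (Ordinal (jn : j < n.+1)%N)) /= : forall j : 'I_n.+1,
  [/\ qpoch (cpow q (A + B + j%:R)) q%:C (n - j) != 0,
      qpoch (cpow q (B - (A + j%:R))) q%:C (n - j).+1 != 0 &
      qpoch (cpow q (1 - (B - (A + j%:R)))) q%:C (n - j) != 0] by near: q.
rewrite !cpowD !cpowN !cpowD !cpowN !cpowD cpow1 // cpow_nat //.
by rewrite -/a -/b (mulrAC a b).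
Unshelve. all: by end_near. Qed.

(** The same device for the hypothesis of [qbernstein_free]. *)
Lemma near_free_denom : \forall q \near (1 : R)^'-, forall i, (i <= n)%N ->
  let a := cpow q A in let b := cpow q B in
  [/\ qpoch (q%:C ^- i) q%:C i != 0, qpoch (b * (b * q%:C ^+ i)) q%:C i != 0,
      qpoch (a / (b * q%:C ^+ i)) q%:C (n - i) != 0 &
      qpoch (a * (b * q%:C ^+ i)) q%:C (n - i) != 0].
Proof.
have : \forall q \near (1 : R)^'-, forall i : 'I_n.+1,
  [/\ qpoch (cpow q (- i%:R)) q%:C i != 0,
      qpoch (cpow q (B + (B + i%:R))) q%:C i != 0,
      qpoch (cpow q (A - (B + i%:R))) q%:C (n - i) != 0 &
      qpoch (cpow q (A + (B + i%:R))) q%:C (n - i) != 0].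
  apply: filter_forall => i; have iN : (i <= n)%N by rewrite -ltnS.
  near=> q; split; near: q; apply: near_qpoch.
  - by apply: rising_neq0 => j ji; rewrite addrC subr_eq0 eqr_nat ltn_eqF.
  (* For [i = 0] the product is empty; [generic_double] starts at 1. *)
  - have [->|i0] := posnP i; first by rewrite /rising big_ord0 oner_neq0.
    by apply: generic_double => //; rewrite mul2n -addnn leq_add.
  - apply: rising_neq0 => j ji.
    have -> : A - (B + i%:R) + j%:R = A - B + j%:R - i%:R by ring.
    apply: generic_diff; last by rewrite ltnW.
    by rewrite (leq_trans (ltnW ji)) // (leq_trans (leq_subr _ _)).
  - by rewrite addrA; apply: generic_rising; rewrite ?inE ?eqxx // subnKC.
move=> h; near=> q => i iN a b.
have /andP[q0 _] : 0 < q < 1 by near: q; exact: near1.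
have /(_ (Ordinal (iN : i < n.+1)%N)) /= : forall i : 'I_n.+1,
  [/\ qpoch (cpow q (- i%:R)) q%:C i != 0,
      qpoch (cpow q (B + (B + i%:R))) q%:C i != 0,
      qpoch (cpow q (A - (B + i%:R))) q%:C (n - i) != 0 &
      qpoch (cpow q (A + (B + i%:R))) q%:C (n - i) != 0] by near: q.
by rewrite !cpowD !cpowN !cpowD cpow_nat.
Unshelve. all: by end_near. Qed.

End Generic.

End Limits.

(** * Existence, uniqueness and limits of the connection coefficients *)

Section ConnectionLimit.
Variables (R : realType) (n m : nat) (A B C D : R[i]).
Hypotheses (hmn : (m <= n)%N) (hn : (1 <= n)%N) (hgen : generic n A B C D).

Definition qconn (q : R) (k : nat) : R[i] :=
  conn_coef n m k (cpow q A) (cpow q B) (cpow q C) (cpow q D) q%:C.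

Lemma binC_neq0 k : (k <= n)%N -> 'C(n, k)%:R != 0 :> R[i].
Proof. by move=> kn; rewrite pnatr_eq0 -lt0n bin_gt0. Qed.

Lemma qC_neq0 (q : R) : 0 < q -> q%:C != 0 :> R[i].
Proof. by move=> q0; rewrite eq_complex /= eqxx andbT (gt_eqF q0). Qed.

Lemma near_connection : \forall q \near (1 : R)^'-,
  connection m A B C D q [ffun k : 'I_n.+1 => qconn q k].
Proof.
near=> q => z z0.
have /andP[q0 _] : 0 < q < 1 by near: q; exact: near1.
rewrite (@askey_wilson_bernstein _ n) ?cpow_neq0 ?qC_neq0 //.
- by apply: eq_bigr => k _; rewrite ffunE.
- exact: binC_neq0.
- by near: q; exact: (near_unity_denom hn hgen).
Unshelve. all: by end_near. Qed.

(** The coefficient families are quantified inside the neighbourhood, so that they may depend on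
    [q]. *)
Lemma near_connection_uniq : \forall q \near (1 : R)^'-,
  forall c c' : {ffun 'I_n.+1 -> R[i]},
  connection m A B C D q c -> connection m A B C D q c' -> c = c'.
Proof.
near=> q => c c' hc hc'.
have /andP[q0 _] : 0 < q < 1 by near: q; exact: near1.
apply/ffunP => k; apply/eqP; rewrite -subr_eq0; apply/eqP.
(* [inord] extends the difference to [nat], as [qbernstein_free] expects, and keeps its values on
   ['I_n.+1]. *)
pose f (i : nat) := c (inord i) - c' (inord i).
suff : f k = 0 by rewrite /f inord_val.
apply: (@qbernstein_free _ n (cpow q A) (cpow q B) q%:C).
- exact: binC_neq0.
- exact: cpow_neq0.
- exact: qC_neq0.
- by near: q; exact: (near_free_denom hn hgen).
- move=> z z0; rewrite -[RHS](subrr (askey_wilson m z (cpow q A) (cpow q B)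
    (cpow q C) (cpow q D) q%:C)) {1}hc // hc' // -sumrB.
  by apply: eq_bigr => i _; rewrite /f inord_val mulrBl.
- by rewrite -ltnS.
Unshelve. all: by end_near. Qed.

Lemma generic_rising0 s j : s \in [:: A + B; A + C; A + D; B + C; B + D] ->
  (j <= n)%N -> rising s j != 0.
Proof.
move=> sin jn; rewrite -[s]addr0.
exact: (generic_rising hn hgen (i := 0) sin jn).
Qed.

(** The orders [3 m - 2 j] of [aw_coef] and [- 2 (n - j)] of [unity_coef] have a sum independent of
    [j], so the limit can be taken termwise. *)
Lemma asym_qconn k : (k <= n)%N ->
  asym ((3 * m)%:Z - (2 * n)%:Z) (fun q => qconn q k)
    (pibar n k A B * omegabar m A B C D * Rracah n m A B C D k).
Proof.
move=> kn.
pose L j := wilson_coef m j A B C D * ('C(n - j, k - j)%:R *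
    (B - (A + j%:R) + (n - j)%:R - 2 * (k - j)%:R) /
    (rising (A + j%:R + B) (n - j) * rising (B - (A + j%:R)) (n - k).+1
     * rising (1 - (B - (A + j%:R))) (k - j))).
have hL (j : 'I_(minn m k).+1) : asym ((3 * m)%:Z - (2 * n)%:Z)
  (fun q => aw_coef m j (cpow q A) (cpow q B) (cpow q C) (cpow q D) q%:C *
    unity_coef q%:C (cpow q A * q%:C ^+ j * cpow q B)
      (cpow q B / (cpow q A * q%:C ^+ j)) (n - j) (k - j)) (L j).
  have : (j <= minn m k)%N by rewrite -ltnS.
  rewrite leq_min => /andP[jm jk]; have jn := leq_trans jk kn.
  have e : (n - j - (k - j) = n - k)%N by rewrite subnBA // subnK.
  have h1 := @asym_aw_coef R m j A B C D
    (generic_rising0 (mem_head _ _) jn)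
    (generic_rising0 (_ : A + C \in _) jn) (generic_rising0 (_ : A + D \in _) jn).
  have h2 := @asym_unity_coef R (A + j%:R + B) (B - (A + j%:R)) (n - j) (k - j).
  rewrite e in h2.
  refine (asym_eq (asymM (h1 _ _) (h2 _ _ _ _)) _ _ erefl).
  - by rewrite !inE eqxx ?orbT.
  - by rewrite !inE eqxx ?orbT.
  - exact: leq_sub2r.
  - by rewrite addrAC; apply: (generic_rising hn hgen); rewrite ?mem_head ?subnKC.
  - apply: (generic_diffl hgen) => //.
    by rewrite ltnS leq_sub2l.
  - by apply: (generic_diffr hgen); rewrite subnKC.
  - by move=> q /andP[q0 _]; rewrite !cpowD !cpowN !cpowD !cpow_nat.
  - by rewrite mulnBr -subzn ?leq_mul2l ?jn ?orbT // opprB addrA subrK.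
refine (asym_eq (asymM (asym_cst ('C(n, k)%:R^-1)) (asym_sum (P := xpredT)
  (fun j _ => hL j))) _ (add0r _) _) => //.
rewrite /Rracah /hypergeom !mulr_sumr; apply: eq_bigr => j _.
have : (j <= minn m k)%N by rewrite -ltnS.
rewrite leq_min => /andP[jm jk]; have jn := leq_trans jk kn.
have h1 : rising (B - A) (n - k).+1 != 0.
  rewrite -[A]addr0; apply: (generic_diffl hgen (j := 0)) => //.
  by rewrite subn0 ltnS leq_subr.
have h2 : rising (A - B + 1) k != 0.
  have -> : A - B + 1 = 1 - (B - (A + 0%:R)) by ring.
  exact: (generic_diffr hgen).
have := unity_limit_racah jk kn h1 h2.
rewrite /L; set u := 'C(n - j, k - j)%:R * _ / _ => E.
(* The denominator [(A + B)_j] is moved from [wilson_coef] to [u], as [unity_limit_racah] requires;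
   thus it disappears from the Racah series. *)
rewrite /wilson_coef [LHS](_ : _ = 'C(n, k)%:R^-1 * omegabar m A B C D *
    (rising (- m%:R) j * rising (A + B + C + D + m%:R - 1) j /
     (rising (A + C) j * rising (A + D) j * j`!%:R)) * (u / rising (A + B) j));
  last by rewrite !invfM; ring.
rewrite E ?big_cons ?big_nil.
(* The inverse binomial of [conn_coef] meets the binomial produced by [unity_limit_racah]. *)
- rewrite !invfM; move: (binC_neq0 kn); move: ('C(n, k)%:R) => c c0.
  rewrite [LHS](_ : _ = (c^-1 * c) * (pibar n k A B * omegabar m A B C D *
    (rising (- m%:R) j * rising (A + B + C + D + m%:R - 1) j *
     (rising (A + C) j)^-1 * (rising (A + D) j)^-1 * j`!%:R^-1 *
     (rising (- k%:R) j * rising (A - B + k%:R - n%:R) j / rising (- n%:R) j))));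
    last by ring.
  by rewrite mulVf // invr1; ring.
- by apply: (generic_diffl hgen) => //; rewrite ltnS leq_sub2l.
- by apply: (generic_diffr hgen); rewrite subnKC.
Qed.

End ConnectionLimit.

Theorem proposition6p1 (R : realType) (n m : nat) (hmn : (m <= n)%N)
    (hn : (1 <= n)%N) (X A B C D : R[i]) (hgen : generic n A B C D) :
  (* for q close to 1 the connection coefficients exist and are unique *)
  (\forall q \near (1 : R)^'-,
     exists! coef : {ffun 'I_n.+1 -> R[i]}, connection m A B C D q coef)
  /\
  (forall coef : R -> {ffun 'I_n.+1 -> R[i]},
     (\forall q \near (1 : R)^'-, connection m A B C D q (coef q)) ->
     let Aqn (k : 'I_n.+1) (q : R) : R[i] :=
       (1 - q)%:C ^ ((2 * n)%:Z - (3 * m)%:Z) * coef q k in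
     let pm (q : R) : R[i] :=
       (1 - q)%:C ^- (3 * m)
       * askey_wilson m (cpow q ('i%C * X)) (cpow q A) (cpow q B) (cpow q C)
           (cpow q D) q%:C in
     let phiA (k : 'I_n.+1) (q : R) : R[i] :=
       (1 - q)%:C ^- (2 * k) * phi k (cpow q ('i%C * X)) (cpow q A) q%:C in
     let phiB (k : 'I_n.+1) (q : R) : R[i] :=
       (1 - q)%:C ^- (2 * (n - k))
       * phi (n - k) (cpow q ('i%C * X)) (cpow q B) q%:C in
     (* the identity divided by (1 - q) ^ (3 m): the powers balance *)
     (\forall q \near (1 : R)^'-,
        pm q = \sum_(k < n.+1) Aqn k q * 'C(n, k)%:R * phiA k q * phiB k q)
     /\ pm q @[q --> (1 : R)^'-] --> (wilson m X A B C D : R[i]^o)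
     /\ (forall k : 'I_n.+1,
           [/\ phiA k q @[q --> (1 : R)^'-] --> (rho k X A : R[i]^o),
               phiB k q @[q --> (1 : R)^'-] --> (rho (n - k) X B : R[i]^o)
             & Aqn k q @[q --> (1 : R)^'-] -->
                 (pibar n k A B * omegabar m A B C D * Rracah n m A B C D k
                  : R[i]^o)]))
  /\ wilson m X A B C D
     = \sum_(k < n.+1) pibar n k A B * omegabar m A B C D
         * Rracah n m A B C D k * 'C(n, k)%:R * rho k X A * rho (n - k) X B
  /\ (forall k : 'I_n.+1,
        Rracah n m A B C D k
        = racah m (A + D - 1) (B + C - 1) (- n%:R - 1) (A - B) k
        /\ lambda n A B k = racah_lambda (- n%:R - 1) (A - B) k).
Proof.
split.
  near=> q; exists [ffun k : 'I_n.+1 => qconn n m A B C D q k]; split.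
    by near: q; exact: near_connection.
  move=> c hc.
  have u : forall c c' : {ffun 'I_n.+1 -> R[i]}, connection m A B C D q c ->
    connection m A B C D q c' -> c = c' by near: q; exact: near_connection_uniq.
  by apply: u hc; near: q; exact: near_connection.
have hphi Y k : (1 - q)%:C ^- (2 * k) * phi k (cpow q ('i%C * X)) (cpow q Y) q%:C
    @[q --> (1 : R)^'-] --> (rho k X Y : R[i]^o).
  by have [h] := asym_phi k X Y; under eq_fun do rewrite exprnN.
have hpm : (1 - q)%:C ^- (3 * m) * askey_wilson m (cpow q ('i%C * X)) (cpow q A)
    (cpow q B) (cpow q C) (cpow q D) q%:C
    @[q --> (1 : R)^'-] --> (wilson m X A B C D : R[i]^o).
  (* The orders are [3 m - 2 j] for the coefficient and [2 j] for [phi j]. *)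
  have hs (j : 'I_m.+1) : asym (3 * m)%:Z (fun q => aw_coef m j (cpow q A)
      (cpow q B) (cpow q C) (cpow q D) q%:C * phi j (cpow q ('i%C * X))
      (cpow q A) q%:C) (wilson_coef m j A B C D * rho j X A).
    have jn : (j <= n)%N by apply: leq_trans hmn; rewrite -ltnS.
    refine (asym_eq (asymM (asym_aw_coef m _ _ _) (asym_phi j X A)) _ (subrK _ _)
      erefl) => //; apply: (generic_rising0 hn hgen) => //;
    by rewrite !inE eqxx ?orbT.
  have [h] := asym_eq (asym_sum (P := xpredT) (fun j _ => hs j))
    (fun q _ => esym (askey_wilson_phi _ _ _ _ _ _ _)) erefl
    (esym (wilson_rho m X A B C D)).
  by under eq_fun do rewrite exprnN.
have hbal (coef : R -> {ffun 'I_n.+1 -> R[i]}) :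
     (\forall q \near (1 : R)^'-, connection m A B C D q (coef q)) ->
  \forall q \near (1 : R)^'-, (1 - q)%:C ^- (3 * m) *
    askey_wilson m (cpow q ('i%C * X)) (cpow q A) (cpow q B) (cpow q C)
      (cpow q D) q%:C =
  \sum_(k < n.+1) (1 - q)%:C ^ ((2 * n)%:Z - (3 * m)%:Z) * coef q k *
    'C(n, k)%:R *
    ((1 - q)%:C ^- (2 * k) * phi k (cpow q ('i%C * X)) (cpow q A) q%:C) *
    ((1 - q)%:C ^- (2 * (n - k)) *
       phi (n - k) (cpow q ('i%C * X)) (cpow q B) q%:C).
  move=> hc; near=> q.
  have q1 : 0 < q < 1 by near: q; exact: near1.
  have c1 : connection m A B C D q (coef q) by near: q.
  rewrite c1 ?cpow_neq0 // mulr_sumr; apply: eq_bigr => k _.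
  have kn : (k <= n)%N by rewrite -ltnS.
  (* The balance of powers: [- 3 m = (2 n - 3 m) - 2 k - 2 (n - k)]. *)
  have -> : (1 - q)%:C ^- (3 * m) = (1 - q)%:C ^ ((2 * n)%:Z - (3 * m)%:Z) *
      (1 - q)%:C ^- (2 * k) * (1 - q)%:C ^- (2 * (n - k)) :> R[i].
    rewrite !exprnN -!expfzDr ?subC_neq0 //; congr (_ ^ _).
    rewrite mulnBr -subzn ?leq_mul2l ?kn ?orbT //.
    by ring.
  by rewrite /qbernstein; ring.
have hA (coef : R -> {ffun 'I_n.+1 -> R[i]}) (k : 'I_n.+1) :
     (\forall q \near (1 : R)^'-, connection m A B C D q (coef q)) ->
  (1 - q)%:C ^ ((2 * n)%:Z - (3 * m)%:Z) * coef q k @[q --> (1 : R)^'-] -->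
  (pibar n k A B * omegabar m A B C D * Rracah n m A B C D k : R[i]^o).
  move=> hc; have kn : (k <= n)%N by rewrite -ltnS.
  (* By uniqueness any admissible family agrees near 1 with the explicit one and inherits its
     limit. *)
  have hq : \forall q \near (1 : R)^'-, qconn n m A B C D q k = coef q k.
    near=> q.
    have u : forall c c' : {ffun 'I_n.+1 -> R[i]}, connection m A B C D q c ->
      connection m A B C D q c' -> c = c'.
      by near: q; exact: (near_connection_uniq m hn hgen).
    rewrite -(u [ffun k : 'I_n.+1 => qconn n m A B C D q k] (coef q)) ?ffunE //.
      by near: q; exact: (near_connection hmn hn hgen).
    by near: q.
  have [h] := asym_near hq (asym_qconn m hn hgen kn).
  by move: h; under eq_fun do rewrite opprB.
split; [|split].
- move=> coef hc /=; split; first exact: hbal.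
  split; first exact: hpm.
  move=> k; split; [exact: hphi | exact: hphi | exact: hA].
(* With the explicit family both sides of the balanced identity converge, and limits are unique. *)
- pose c q := [ffun k : 'I_n.+1 => qconn n m A B C D q k].
  have hc : \forall q \near (1 : R)^'-, connection m A B C D q (c q).
    exact: near_connection.
  apply: (cvg_unique (@norm_hausdorff R[i] R[i]^o) hpm).
  have hs : \sum_(k < n.+1) (1 - q)%:C ^ ((2 * n)%:Z - (3 * m)%:Z) * c q k *
      'C(n, k)%:R *
      ((1 - q)%:C ^- (2 * k) * phi k (cpow q ('i%C * X)) (cpow q A) q%:C) *
      ((1 - q)%:C ^- (2 * (n - k)) *
         phi (n - k) (cpow q ('i%C * X)) (cpow q B) q%:C) @[q --> (1 : R)^'-] -->
    (\sum_(k < n.+1) pibar n k A B * omegabar m A B C D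
         * Rracah n m A B C D k * 'C(n, k)%:R * rho k X A * rho (n - k) X B
      : R[i]^o).
    apply: (@cvg_big R[i]^o 'I_n.+1 +%R 0 xpredT); first exact: add_continuous.
    move=> k _; apply: cvgM; last exact: hphi.
    apply: cvgM; last exact: hphi.
    apply: cvgM; last exact: (@cvg_cst R[i]^o).
    exact: hA.
  apply: cvg_trans hs; apply: near_eq_cvg.
  by apply: filterS (hbal _ hc) => q ->.
- move=> k; split; last by rewrite /lambda /racah_lambda; ring.
  (* Both series stop at [minn m k], so only parameters are compared; for instance
     [beta + delta + 1 = A + C] and [gamma + 1 = - n]. *)
  rewrite /Rracah /racah; congr hypergeom.
  + by do 2! congr (_ :: _); [ring | congr (_ :: _); congr (_ :: _); ring].
  + by congr [:: _; _; _]; ring.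
Unshelve. all: by end_near. Qed.
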